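(* Let $M=M^*\in\mathbb{C}^{n\times n}$ be $\beta$-banded and positive definite with smallest eigenvalue $\lambda_{\min}$, let $\widehat M=M-\lambda_{\min}I$, and let $\mathcal{A}=M\otimes I+I\otimes M$. Let $f$ be a Laplace--Stieltjes function, written as $f(x)=\int_0^\infty\mathrm{e}^{-x\tau}\,\mathrm{d}\alpha(\tau)$ for $x>0$. Then for all indices $k=(k_1,k_2)$ and $t=(t_1,t_2)$, $$|(f(\mathcal{A}))_{kt}|\le\int_0^\infty\exp(-2\lambda_{\min}\tau)\,|(\exp(-\tau\widehat M))_{k_1t_1}|\,|(\exp(-\tau\widehat M))_{k_2t_2}|\,\mathrm{d}\alpha(\tau).$$
   Context: A matrix $M\in\mathbb{C}^{n\times n}$ is $\beta$-banded if $M_{ij}=0$ whenever $|i-j|>\beta$. $I$ is the $n\times n$ identity and $\otimes$ the Kronecker product. Lexicographic ordering is used: a row/column index $k\in\{1,\dots,n^2\}$ of $\mathcal{A}$ corresponds to the pair $k=(k_1,k_2)\in\{1,\dots,n\}^2$ with $k=(k_2-1)n+k_1$. A Laplace--Stieltjes function is a function $f$ that is strictly completely monotonic on $(0,\infty)$, i.e. $(-1)^kf^{(k)}(x)>0$ for all $x>0$ and all $k=0,1,2,\dots$. By Bernstein's theorem such an $f$ can be written as $f(x)=\int_0^\infty\mathrm{e}^{-\tau x}\,\mathrm{d}\alpha(\tau)$ with $\alpha$ nondecreasing on $[0,\infty)$ and the (Stieltjes) integral convergent for all $x>0$; $\alpha$ denotes such a function. $f(\mathcal{A})$ is defined by the usual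 functional calculus for Hermitian matrices. *)

(* Defs.v *)
From HB Require Import structures.
From mathcomp Require Import all_boot all_order all_algebra.
From mathcomp Require Import complex mxtens.
From mathcomp Require Import all_classical all_reals all_analysis.

Set Implicit Arguments.
Unset Strict Implicit.
Unset Printing Implicit Defensive.

Import Order.TTheory GRing.Theory Num.Theory.
Import numFieldNormedType.Exports.

Local Open Scope classical_set_scope.
Local Open Scope ring_scope.
Local Open Scope complex_scope.
Local Open Scope sesquilinear_scope.

Definition banded (K : nmodType) (n beta : nat) (M : 'M[K]_n) : Prop :=
  forall i j : 'I_n, (beta < `|i%:Z - j%:Z|)%N -> M i j = 0.

Definition posdefmx (C : numClosedFieldType) (n : nat) (M : 'M[C]_n) : Prop :=
  forall v : 'cV[C]_n, v != 0 -> 0 < (v ^t* *m M *m v) 0 0.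

Definition smallest_eigenvalue (R : rcfType) (n : nat) (M : 'M[R[i]]_n)
    (lmin : R) : Prop :=
  eigenvalue M lmin%:C /\ forall mu : R[i], eigenvalue M mu -> lmin%:C <= mu.

(* Functional calculus of a Hermitian matrix A = P^-1 D P, with P unitary and
   D real diagonal: f(A) = P^-1 f(D) P.  The value does not depend on the
   diagonalization, and is meaningful only when A is Hermitian. *)
Definition herm_fun (R : rcfType) (n : nat) (f : R -> R) (A : 'M[R[i]]_n) :
    'M[R[i]]_n :=
  invmx (spectralmx A)
    *m diag_mx (map_mx (fun z : R[i] => (f (complex.Re z))%:C) (spectral_diag A))
    *m spectralmx A.

Definition laplace_stieltjes_fun (R : realType) (f : R -> R) : Prop :=
  forall (k : nat) (x : R), 0 < x ->
    derivable (derive1n k f) x 1 /\ 0 < (-1) ^+ k * derive1n k f x.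

(* The integral against d alpha over [0, +oo[ only depends on alpha through
   its right limits and the value alpha 0 : alpha is extended by the constant
   alpha 0 on the left of 0 and then made right-continuous.  The resulting
   measure has mass alpha(0+) - alpha(0) at 0. *)
Definition right_reg (R : realType) (alpha : R -> R) (x : R) : R :=
  lim (alpha (Num.max 0 y) @[y --> x^'+]).

Section Regularization.
Variables (R : realType) (alpha : R -> R).
Hypothesis nd_alpha : {in `[0, +oo[ &, {homo alpha : x y / x <= y}}.

Let beta (x : R) := alpha (Num.max 0 x).

Let beta_nd (x y : R) : x <= y -> beta x <= beta y.
Proof.
move=> xy; apply: nd_alpha.
- by rewrite in_itv/= andbT le_max lexx.
- by rewrite in_itv/= andbT le_max lexx.
- by rewrite ge_max !le_max lexx xy orbT.
Qed.

Let reg_cvg (x : R) : beta y @[y --> x^'+] --> right_reg alpha x.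
Proof.
apply: (@nondecreasing_at_right_is_cvgr R beta x).
  by near=> z => u v _ _; exact: beta_nd.
near=> z; exists (beta x) => _ [u /= + <-].
by rewrite in_itv/= => /andP[/ltW xu _]; exact: beta_nd.
Unshelve. all: by end_near. Qed.

Let reg_le (x y : R) : x < y -> right_reg alpha x <= beta y.
Proof.
move=> xy; apply: (cvgr_to_le (@reg_cvg x)).
by near=> z; apply/beta_nd/ltW; near: z; exact: nbhs_right_lt.
Unshelve. all: by end_near. Qed.

Let le_reg (x : R) : beta x <= right_reg alpha x.
Proof.
apply: (cvgr_to_ge (@reg_cvg x)).
by near=> z; apply/beta_nd; near: z; exact: nbhs_right_ge.
Unshelve. all: by end_near. Qed.

Lemma right_reg_nondecreasing : nondecreasing (right_reg alpha).
Proof.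
move=> x y; rewrite le_eqVlt => /predU1P[->//|xy].
exact: le_trans (reg_le xy) (le_reg y).
Qed.

Lemma right_reg_right_continuous : right_continuous (right_reg alpha).
Proof.
move=> x; apply/cvgrPdist_le => e e0.
have /cvgrPdist_le/(_ e e0) := @reg_cvg x.
rewrite /at_right /within /= => /nbhs_ballP[d /= d0 xd].
apply/nbhs_ballP; exists (d / 2) => /=; first by rewrite divr_gt0.
move=> y; rewrite /ball/= => xy ltxy.
have d20 : 0 < d / 2 by rewrite divr_gt0.
have z0 : y < y + d / 2 by rewrite ltrDl.
have := xd (y + d / 2).
rewrite /ball/= opprD addrA => /(_ _ (lt_trans ltxy z0)).
have -> : `|x - y - d / 2| < d.
  apply: le_lt_trans (ler_normB _ _) _.
  by rewrite [ltRHS]splitr (gtr0_norm d20) ltr_leD.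
move=> /(_ isT).
have h1 := right_reg_nondecreasing (ltW ltxy).
have h2 := reg_le z0.
rewrite distrC ger0_norm ?subr_ge0; last exact: le_trans h1 h2.
rewrite distrC ger0_norm ?subr_ge0// => h3.
by apply: le_trans h3; rewrite lerB.
Qed.

Definition right_reg_cumulative : cumulative R R :=
  HB.pack (right_reg alpha)
    (isCumulative.Build R _ R (right_reg alpha)
       right_reg_nondecreasing right_reg_right_continuous).

End Regularization.

(* Main.v *)
Require Import Defs.
From HB Require Import structures.
From mathcomp Require Import all_boot all_order all_algebra.
From mathcomp Require Import complex mxtens.
From mathcomp Require Import all_classical all_reals all_analysis.
From mathcomp Require Import measurable_realfun ring.

(* Diagonalize M = P^* diag(d) P with P unitary.  Then A is diagonalized by
   the unitary P (x) P with eigenvalues d_i + d_j > 0, so an entry of f(A) is a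
   complex linear combination of the values f(d_i + d_j), that is, the integral
   of the same combination of the exponentials exp(-(d_i + d_j) tau).  That
   integrand is an entry of exp(-tau A), which splits as
   exp(-2 lmin tau) exp(-tau Mhat) (x) exp(-tau Mhat), and the modulus of an
   integral is at most the integral of the modulus. *)

Set Implicit Arguments.
Unset Strict Implicit.
Unset Printing Implicit Defensive.

Import Order.TTheory GRing.Theory Num.Theory.
Import numFieldNormedType.Exports.

Local Open Scope classical_set_scope.
Local Open Scope ring_scope.
Local Open Scope complex_scope.

(** * Kronecker products of diagonal and unitary matrices; change of eigenbasis *)

Lemma tens_diag_mx (R : pzRingType) m n (d : 'rV[R]_m) (e : 'rV[R]_n) :
  diag_mx d *t diag_mx e =
  diag_mx (\row_s (d 0 (mxtens_unindex s).1 * e 0 (mxtens_unindex s).2)).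
Proof.
apply/matrixP => i j.
case: (mxtens_indexP i) => i1 i2; case: (mxtens_indexP j) => j1 j2.
rewrite tensmxE !mxE mxtens_indexK/= (can_eq (@mxtens_indexK _ _)) xpair_eqE.
by case: (i1 == j1); case: (i2 == j2); rewrite /= ?(mulr0n, mulr1n, mul0r, mulr0).
Qed.

Lemma tensmx_unitary (C : numClosedFieldType) m n p q
    (A : 'M[C]_(m, n)) (B : 'M[C]_(p, q)) :
  A \is unitarymx -> B \is unitarymx -> A *t B \is unitarymx.
Proof.
move=> /unitarymxP Au /unitarymxP Bu; apply/unitarymxP.
rewrite trmx_tens map_mxT tensmx_mul Au Bu -!diag_const_mx tens_diag_mx.
by congr diag_mx; apply/rowP => i; rewrite !mxE mulr1.
Qed.

(* The matrix passing from one eigenbasis to the other intertwines the two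
   diagonal forms, so its (i, j) entry vanishes unless the i-th and j-th
   eigenvalues agree; hence it also intertwines their images under h. *)
Lemma diagonalization_map (F : fieldType) n (h : F -> F) (P Q : 'M[F]_n)
    (d e : 'rV[F]_n) :
  P \in unitmx -> Q \in unitmx ->
  invmx P *m diag_mx d *m P = invmx Q *m diag_mx e *m Q ->
  invmx P *m diag_mx (map_mx h d) *m P = invmx Q *m diag_mx (map_mx h e) *m Q.
Proof.
move=> PU QU PQ.
have X_intertwines : diag_mx d *m (P *m invmx Q) = P *m invmx Q *m diag_mx e.
  move: PQ => /(congr1 (fun A => P *m A *m invmx Q)).
  by rewrite !mulmxA mulmxV// mul1mx mulmxK.
suff hX : diag_mx (map_mx h d) *m (P *m invmx Q) =
    P *m invmx Q *m diag_mx (map_mx h e).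
  apply: (can_inj (mulKmx PU)); rewrite !mulmxA mulmxV// mul1mx -hX.
  by rewrite !mulmxA mulmxKV.
apply/matrixP => i j; move/matrixP: X_intertwines => /(_ i j).
rewrite !mul_diag_mx !mul_mx_diag !mxE.
set x := \sum_k _; have [->|x0] := eqVneq x 0; first by rewrite !mulr0 !mul0r.
by rewrite mulrC => /(mulfI x0) ->; rewrite mulrC.
Qed.

(** * Matrices diagonalized by a given unitary matrix *)

Section UnitaryDiag.
Local Open Scope sesquilinear_scope.
Variable R : rcfType.

(** The eigenvalues form a real-valued function, so that with [P] fixed, sums, real multiples and
    functions of matrices become pointwise operations on [d]. *)
Definition unitary_diag n (P : 'M[R[i]]_n) (d : 'I_n -> R) : 'M[R[i]]_n :=
  P^t* *m diag_mx (\row_i (d i)%:C) *m P.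

Lemma unitary_diagE n (P : 'M[R[i]]_n) d i j :
  unitary_diag P d i j = \sum_a (P a i)^* * P a j * (d a)%:C.
Proof.
rewrite /unitary_diag mul_mx_diag mxE; apply: eq_bigr => a _.
by rewrite !mxE mulrAC.
Qed.

Lemma unitary_diagD n (P : 'M[R[i]]_n) d e :
  unitary_diag P d + unitary_diag P e = unitary_diag P (fun i => d i + e i).
Proof.
apply/matrixP => i j; rewrite [LHS]mxE !(unitary_diagE P) -big_split /=.
by apply: eq_bigr => a _; rewrite rmorphD /= mulrDr.
Qed.

Lemma unitary_diagZ n (P : 'M[R[i]]_n) (c : R) d :
  c%:C *: unitary_diag P d = unitary_diag P (fun i => c * d i).
Proof.
apply/matrixP => i j; rewrite [LHS]mxE !(unitary_diagE P) mulr_sumr.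
by apply: eq_bigr => a _; rewrite rmorphM /= mulrCA.
Qed.

(** A scalar matrix is diagonal in every orthonormal basis; this lets the identity factors of [A]
    and the shift in [Mhat] share the eigenbasis of [M]. *)
Lemma unitary_diag_scalar n (P : 'M[R[i]]_n) (c : R) :
  P \is unitarymx -> unitary_diag P (fun=> c) = c%:C%:M.
Proof.
move=> Pu; rewrite /unitary_diag.
have -> : diag_mx (\row_(_ < n) c%:C) = c%:C%:M.
  by rewrite -diag_const_mx; congr diag_mx; apply/rowP => i; rewrite !mxE.
rewrite mul_mx_scalar -scalemxAl -(invmx_unitary Pu) mulVmx ?unitarymx_unit//.
by rewrite scalemx1.
Qed.

Lemma tensmx_unitary_diag n p (P : 'M[R[i]]_n) (Q : 'M[R[i]]_p) d e :
  unitary_diag P d *t unitary_diag Q e =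
  unitary_diag (P *t Q) (fun s => d (mxtens_unindex s).1 * e (mxtens_unindex s).2).
Proof.
rewrite /unitary_diag -(tensmx_mul _ _ P Q) -tensmx_mul trmx_tens map_mxT.
rewrite tens_diag_mx; set r := \row_s _; set r' := \row_s _.
by have -> : r = r' by apply/rowP => s; rewrite !mxE rmorphM.
Qed.

(** [herm_fun] uses the diagonalization chosen by [spectralmx]; [diagonalization_map] transports it
    to the one given by [P] and [d]. *)
Lemma herm_fun_unitary_diag n f (P : 'M[R[i]]_n) (d : 'I_n -> R) :
  P \is unitarymx ->
  herm_fun f (unitary_diag P d) = unitary_diag P (fun i => f (d i)).
Proof.
move=> Pu; pose A := unitary_diag P d.
have AE : A = invmx P *m diag_mx (\row_i (d i)%:C) *m P.
  by rewrite (invmx_unitary Pu).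
have An : A \is normalmx.
  by apply/orthomx_spectral_subproof; exists (P, \row_i (d i)%:C).
rewrite /herm_fun -/A (diagonalization_map _ (spectral_unit A)
  (unitarymx_unit Pu) (etrans (esym (orthomx_spectralP An)) AE)).
rewrite (invmx_unitary Pu) /unitary_diag; set r := map_mx _ (\row_i _); set r' := \row_i _.
by have -> : r = r' by apply/rowP => i; rewrite !mxE.
Qed.

Lemma hermsymmx_unitary_diag n (M : 'M[R[i]]_n) : M \is hermsymmx ->
  exists2 P : 'M[R[i]]_n, P \is unitarymx & exists d, M = unitary_diag P d.
Proof.
move=> Mh; exists (spectralmx M); first exact: spectral_unitarymx.
exists (fun i => complex.Re (spectral_diag M 0 i)).
rewrite {1}(orthomx_spectralP (hermitian_normalmx Mh)) /unitary_diag.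
rewrite (invmx_unitary (spectral_unitarymx M)); congr (_ *m diag_mx _ *m _).
apply/rowP => i; rewrite !mxE RRe_real//.
by have /mxOverP := hermitian_spectral_diag_real Mh.
Qed.

Lemma posdef_unitary_diag_gt0 n (P : 'M[R[i]]_n) d i :
  P \is unitarymx -> posdefmx (unitary_diag P d) -> 0 < d i.
Proof.
(* The test vector is column [i] of [P^t*], a unit eigenvector, at which the quadratic form takes
   the value [d i]. *)
move=> Pu /(_ (P^t* *m delta_mx i 0)).
have PP : P *m P^t* = 1%:M by apply/unitarymxP.
have v0 : P^t* *m delta_mx i 0 != 0 :> 'cV_n.
  apply/eqP => /(congr1 (mulmx P)); rewrite mulmxA PP mul1mx mulmx0.
  by move/matrixP/(_ i 0)/eqP; rewrite !mxE !eqxx oner_eq0.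
move=> /(_ v0).
rewrite trmx_mul map_mxM trmxCK /unitary_diag !mulmxA.
rewrite -[_ *m P *m P^t*]mulmxA PP mulmx1.
rewrite -[_ *m P *m P^t*]mulmxA PP mulmx1.
rewrite -mulmxA -colE trmx_delta map_delta_mx -rowE !mxE eqxx mulr1n.
by rewrite ltcR.
Qed.

End UnitaryDiag.

(** * Modulus of the integral of a complex combination of real functions *)

Section NormcIntegral.
Variable R : realType.
Implicit Types (z : R[i]).

Lemma Re_sumMr (I : finType) (w : I -> R[i]) (c : I -> R) :
  complex.Re (\sum_s w s * (c s)%:C) = \sum_s complex.Re (w s) * c s.
Proof.
rewrite (big_morph (@complex.Re R) (id1 := 0) (op1 := +%R)); last 2 first.
- by case=> a b [? ?].
- by [].
by apply: eq_bigr => s _; case: (w s) => a b /=; rewrite mulr0 subr0.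
Qed.

Lemma Im_sumMr (I : finType) (w : I -> R[i]) (c : I -> R) :
  complex.Im (\sum_s w s * (c s)%:C) = \sum_s complex.Im (w s) * c s.
Proof.
rewrite (big_morph (@complex.Im R) (id1 := 0) (op1 := +%R)); last 2 first.
- by case=> a b [? ?].
- by [].
by apply: eq_bigr => s _; case: (w s) => a b /=; rewrite mulr0 add0r.
Qed.

Lemma normcE z :
  Normc.normc z = Num.sqrt (complex.Re z ^+ 2 + complex.Im z ^+ 2).
Proof. by case: z. Qed.

Lemma ler_Re_normc z : `|complex.Re z| <= Normc.normc z.
Proof. by rewrite -lecR; exact: normc_ge_Re. Qed.

Lemma normc_ge0 z : 0 <= Normc.normc z.
Proof. by rewrite normcE sqrtr_ge0. Qed.

(** Rotating by [u] turns a modulus into a real part, which, unlike the modulus, commutes with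
    integration. *)
Lemma exists_phase z :
  exists2 u : R[i], Normc.normc u = 1 & complex.Re (u * z) = Normc.normc z.
Proof.
have [->|z0] := eqVneq z 0.
  by exists 1; rewrite ?Normc.normc1// mulr0 Normc.normc0.
have nz0 : Normc.normc z != 0.
  by apply/eqP => /Normc.eq0_normc/eqP; exact/negP.
have nzC : (Normc.normc z)%:C != 0 :> R[i].
  by rewrite -[0]/(0%:C) (inj_eq (@complexI R)).
exists ((Normc.normc z)%:C / z).
  rewrite Normc.normcM Normc.normcV normcE/= expr0n addr0 sqrtr_sqr.
  by rewrite ger0_norm ?normc_ge0// divff.
by rewrite mulfVK.
Qed.

(** Let [u] be the phase of the combination of the integrals. Its modulus is then the integral of
    the real part of [u] times the integrand, and that real part is at most the modulus of the
    integrand since [u] has modulus 1. *)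
Lemma normc_integral_le d (T : measurableType d)
    (mu : {measure set T -> \bar R}) (D : set T) (I : finType)
    (w : I -> R[i]) (g : I -> T -> R) (c : I -> R) :
  measurable D ->
  (forall s, mu.-integrable D (EFin \o g s)) ->
  (forall s, (c s)%:E = \int[mu]_(x in D) (g s x)%:E)%E ->
  ((Normc.normc (\sum_s w s * (c s)%:C))%:E <=
    \int[mu]_(x in D) (Normc.normc (\sum_s w s * (g s x)%:C))%:E)%E.
Proof.
move=> mD ig cE.
have mg s : measurable_fun D (g s).
  by apply/measurable_EFinP; case/integrableP: (ig s).
have [u u1 <-] := exists_phase (\sum_s w s * (c s)%:C).
have uE (e : I -> R) : complex.Re (u * \sum_s w s * (e s)%:C) =
    \sum_s complex.Re (u * w s) * e s.
  by rewrite mulr_sumr -Re_sumMr; under eq_bigr do rewrite mulrA.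
have -> : (complex.Re (u * \sum_s w s * (c s)%:C))%:E =
    (\int[mu]_(x in D) (complex.Re (u * \sum_s w s * (g s x)%:C))%:E)%E.
  under eq_integral do rewrite uE -sumEFin.
  rewrite integral_sum//; last first.
    by move=> s; under eq_fun do rewrite EFinM; exact: (integrableZl mD _ (ig s)).
  rewrite uE -sumEFin; apply: eq_bigr => s _.
  under eq_integral do rewrite EFinM.
  by rewrite (integralZl mD (ig s)) -cE.
apply: le_trans (lee_abs _) _.
have mRe : measurable_fun D
    (fun x => complex.Re (u * \sum_s w s * (g s x)%:C)).
  under eq_fun do rewrite uE.
  by apply: measurable_sum => s; exact: measurable_funM.
apply: le_trans (le_abse_integral mu mD _) _; first exact/measurable_EFinP.
apply: ge0_le_integral => //.
- exact/measurable_EFinP/measurableT_comp.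
- apply/measurable_EFinP.
  under eq_fun do rewrite normcE Re_sumMr Im_sumMr.
  apply: measurableT_comp.
    by apply: continuous_measurable_fun; exact: sqrt_continuous.
  by apply: measurable_funD; apply: measurable_funX;
    apply: measurable_sum => s; exact: measurable_funM.
- move=> x Dx; rewrite lee_fin; apply: le_trans (ler_Re_normc _) _.
  by rewrite Normc.normcM u1 mul1r.
Qed.

End NormcIntegral.

Theorem mainTheorem7 (R : realType) (n beta : nat) (M : 'M[R[i]]_n)
    (lmin : R) (f alpha : R -> R)
    (nd_alpha : {in `[0, +oo[ &, {homo alpha : x y / x <= y}}) :
  M \is hermsymmx -> banded beta M -> posdefmx M ->
  smallest_eigenvalue M lmin ->
  laplace_stieltjes_fun f ->
  (forall x : R, 0 < x ->
    ((f x)%:E =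
     \int[lebesgue_stieltjes_measure (right_reg_cumulative nd_alpha)]_(tau in `[0%R, +oo[)
       (expR (- (x * tau)))%:E)%E) ->
  let Mhat : 'M[R[i]]_n := M - lmin%:C%:M in
  let A : 'M[R[i]]_(n * n) := M *t 1%:M + 1%:M *t M in
  forall (k t : 'I_(n * n)) (k1 k2 t1 t2 : 'I_n),
    k = (k2 * n + k1)%N :> nat -> t = (t2 * n + t1)%N :> nat ->
    ((Normc.normc (herm_fun f A k t))%:E <=
     \int[lebesgue_stieltjes_measure (right_reg_cumulative nd_alpha)]_(tau in `[0%R, +oo[)
       (expR (- (2 * lmin * tau))
         * Normc.normc (herm_fun expR ((- tau)%:C *: Mhat) k1 t1)
         * Normc.normc (herm_fun expR ((- tau)%:C *: Mhat) k2 t2))%:E)%E.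
Proof.
move=> /hermsymmx_unitary_diag[P Pu [d ->]] _ Mpos _ _ fE Mhat A k t k1 k2 t1 t2.
move=> kE tE.
(* [mxtens_index (i, j)] is [i * n + j], whereas in the lexicographic ordering the first component
   varies fastest; hence the swapped pair. *)
have {kE} -> : k = mxtens_index (k2, k1) by exact: val_inj.
have {tE} -> : t = mxtens_index (t2, t1) by exact: val_inj.
have d_gt0 i : 0 < d i by exact: posdef_unitary_diag_gt0 Pu Mpos.
pose e (s : 'I_(n * n)) := d (mxtens_unindex s).1 + d (mxtens_unindex s).2.
have e_gt0 s : 0 < e s by rewrite addr_gt0.
have PPu : P *t P \is unitarymx by exact: tensmx_unitary.
have -> : A = unitary_diag (P *t P) e.
  (* With the identity written in the eigenbasis [P], both Kronecker summands are diagonal in the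
     basis [P *t P]. *)
  rewrite /A -(unitary_diag_scalar 1 Pu) !tensmx_unitary_diag unitary_diagD.
  by congr unitary_diag; apply/funext => s; rewrite mulr1 mul1r.
have expMhat tau : herm_fun expR ((- tau)%:C *: Mhat) =
    unitary_diag P (fun i => expR (- tau * (d i - lmin))).
  have -> : Mhat = unitary_diag P d + (-1)%:C *: unitary_diag P (fun=> lmin).
    by rewrite /Mhat rmorphN1 scaleN1r unitary_diag_scalar.
  rewrite (unitary_diagZ P) (unitary_diagD P) (unitary_diagZ P).
  rewrite (herm_fun_unitary_diag _ _ Pu).
  by congr unitary_diag; apply/funext => i; rewrite mulN1r.
set mu := lebesgue_stieltjes_measure _.
(* The integrand is the modulus of an entry of exp(-tau A): in each exponent, 2 [lmin] + (d_i -
   [lmin]) + (d_j - [lmin]) = d_i + d_j. *)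
have -> : (\int[mu]_(tau in `[0%R, +oo[)
       (expR (- (2 * lmin * tau))
         * Normc.normc (herm_fun expR ((- tau)%:C *: Mhat) k1 t1)
         * Normc.normc (herm_fun expR ((- tau)%:C *: Mhat) k2 t2))%:E =
    \int[mu]_(tau in `[0%R, +oo[)
      (Normc.normc (\sum_s ((P *t P) s (mxtens_index (k2, k1)))^*
        * (P *t P) s (mxtens_index (t2, t1)) * (expR (- (e s * tau)))%:C))%:E)%E.
  apply: eq_integral => tau _; congr EFin.
  rewrite -unitary_diagE !expMhat -mulrA [X in _ * X]mulrC -Normc.normcM.
  rewrite -tensmxE tensmx_unitary_diag.
  (* The positive prefactor is its own modulus, so it can be moved inside. *)
  have -> : expR (- (2 * lmin * tau)) = Normc.normc (expR (- (2 * lmin * tau)))%:C.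
    by rewrite normcE/= expr0n addr0 sqrtr_sqr ger0_norm ?expR_ge0.
  rewrite -Normc.normcM; congr Normc.normc.
  set X := unitary_diag _ _; set Y := unitary_diag _ _.
  have <- : (expR (- (2 * lmin * tau)))%:C *: X = Y; last by rewrite [RHS]mxE.
  rewrite /X (unitary_diagZ (P *t P)); congr unitary_diag; apply/funext => s.
  by rewrite -!expRD; congr expR; rewrite /e; ring.
rewrite herm_fun_unitary_diag// unitary_diagE.
apply: normc_integral_le => // s; last by rewrite fE.
apply/integrableP; split.
  apply/measurable_EFinP; apply: measurableT_comp => //.
  by apply: measurableT_comp => //; exact: measurable_funM.
(* The exponential is nonnegative, so the integral of its absolute value is the real number
   [f (e s)], with [e s] positive. *)
under eq_integral do rewrite /= ger0_norm ?expR_ge0//.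
by rewrite -fE// ltry.
Qed.
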